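(* Let $S$ be a commutative ring, $x\in S$ a non-zerodivisor, and $R=S/(x)$. To a matrix factorization $(F,G,\phi,\psi)$ of $x$ over $S$ assign the complex $$\cdots\to F/xF\xrightarrow{\overline{\phi}}G/xG\xrightarrow{\overline{\psi}}F/xF\xrightarrow{\overline{\phi}}G/xG\to\cdots$$ of free $R$-modules, where $\overline{\phi},\overline{\psi}$ are the reductions of $\phi,\psi$ modulo $x$, and to a morphism $(f,g)$ of matrix factorizations assign the morphism of complexes given by the reductions $\overline{f}$ and $\overline{g}$ modulo $x$. This assignment induces a triangle functor $$T\colon\mathbf{HMF}(S,x)\to\mathbf{K_{tac}}(\operatorname{proj}R)$$ which is fully faithful.
   Context: A matrix factorization $(F,G,\phi,\psi)$ of $x$ over $S$ consists of finitely generated free $S$-modules $F,G$ and $S$-homomorphisms $F\xrightarrow{\phi}G\xrightarrow{\psi}F$ with $\psi\circ\phi=x\cdot1_F$ and $\phi\circ\psi=x\cdot1_G$. A morphism $\theta=(f,g)\colon(F_1,G_1,\phi_1,\psi_1)\to(F_2,G_2,\phi_2,\psi_2)$ is a pair of homomorphisms $f\colon F_1\to F_2$, $g\colon G_1\to G_2$ with $g\phi_1=\phi_2f$ and $f\psi_1=\psi_2g$. Two morphisms $(f,g)$ and $(f',g')$ are homotopic if there are $s\colon G_1\to F_2$ and $t\colon F_1\to G_2$ with $f-f'=s\phi_1+\psi_2t$ and $g-g'=t\psi_1+\phi_2s$. The homotopy category $\mathbf{HMF}(S,x)$ has matrix factorizations of $x$ as objects and homotopy classes of morphisms as morphisms.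 It is triangulated, with suspension $\Sigma(F,G,\phi,\psi)=(G,F,-\psi,-\phi)$ and distinguished triangles those isomorphic to the standard triangles $(F_1,G_1,\phi_1,\psi_1)\xrightarrow{[\theta]}(F_2,G_2,\phi_2,\psi_2)\xrightarrow{[i_\theta]}C_\theta\xrightarrow{[\pi_\theta]}\Sigma(F_1,G_1,\phi_1,\psi_1)$, where the mapping cone $C_\theta$ is $$G_1\oplus F_2\xrightarrow{\left[\begin{smallmatrix}-\psi_1&0\\ g&\phi_2\end{smallmatrix}\right]}F_1\oplus G_2\xrightarrow{\left[\begin{smallmatrix}-\phi_1&0\\ f&\psi_2\end{smallmatrix}\right]}G_1\oplus F_2,$$ and $i_\theta$, $\pi_\theta$ are the canonical inclusion and projection. A complex $M$ (unbounded) of finitely generated projective $R$-modules is totally acyclic if both $M$ and $\operatorname{Hom}_R(M,R)$ are acyclic. $\mathbf{K_{tac}}(\operatorname{proj}R)$ is the homotopy category of totally acyclic complexes of finitely generated projective $R$-modules, triangulated with the usual shift of complexes as suspension and with distinguished triangles those isomorphic to the standard mapping cone triangles. In the complex assigned to $(F,G,\phi,\psi)$, the modules $F/xF$ sit in even degrees and the modules $G/xG$ in odd degrees. *)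

(* Defs.v *)
From HB Require Import structures.
From mathcomp Require Import all_boot all_algebra.
From mathcomp Require Import boolp.
From mathcomp Require Import zify.

Set Implicit Arguments.
Unset Strict Implicit.
Unset Printing Implicit Defensive.

Import GRing.Theory.
Local Open Scope ring_scope.
Local Open Scope quotient_scope.

Section ModX.
Variables (S : comPzRingType) (x : S).

(* the submodule xF of F *)
Definition xmul (F : lmodType S) : {pred F} :=
  fun v => `[< exists w, v = x *: w >].
Arguments xmul : clear implicits.

Lemma xmulP (F : lmodType S) (v : F) : reflect (exists w, v = x *: w) (v \in xmul F).
Proof. exact: asboolP. Qed.

Lemma xmul_zmod_closed (F : lmodType S) : zmod_closed (xmul F).
Proof.
split; first by apply/xmulP; exists 0; rewrite scaler0.
move=> u v /xmulP[u' ->] /xmulP[v' ->].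
by apply/xmulP; exists (u' - v'); rewrite scalerBr.
Qed.
HB.instance Definition _ (F : lmodType S) :=
  GRing.isZmodClosed.Build F (xmul F) (xmul_zmod_closed F).

(* F / xF *)
Definition modx (F : lmodType S) : Type := Quotient.quot (xmul F).
HB.instance Definition _ (F : lmodType S) := GRing.Zmodule.on (modx F).

Definition prx (F : lmodType S) (v : F) : modx F := \pi_(Quotient.quot (xmul F)) v.
Definition liftx (F : lmodType S) (v : modx F) : F :=
  repr (v : Quotient.quot (xmul F)).

Lemma liftxK (F : lmodType S) (v : modx F) : prx (liftx v) = v.
Proof. exact: reprK. Qed.

Lemma prxP (F : lmodType S) (u v : F) : prx u = prx v <-> exists w, u - v = x *: w.
Proof.
split=> [/eqP|uv]; first by rewrite -Quotient.idealrBE => /xmulP.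
by apply/eqP; rewrite -Quotient.idealrBE; apply/xmulP.
Qed.

Lemma prxD (F : lmodType S) (u v : F) : prx (u + v) = prx u + prx v.
Proof. exact: Quotient.pi_add. Qed.

Lemma prx0 (F : lmodType S) : prx (0 : F) = 0.
Proof. by apply: (addrI (prx 0)); rewrite -prxD !addr0. Qed.

(* S / (x); it is the zero ring when x is a unit, hence the use of pzRings
   (ring_quotient only covers quotients by proper ideals) *)
Definition quox : Type := modx S^o.
HB.instance Definition _ := GRing.Zmodule.on quox.

Definition prq (a : S) : quox := prx (a : S^o).
Definition liftq (a : quox) : S := liftx a.
Definition quox_mul (a b : quox) : quox := prq (liftq a * liftq b).

Lemma liftqK a : prq (liftq a) = a. Proof. exact: liftxK. Qed.

Lemma prqP a b : prq a = prq b <-> exists c, a - b = x * c.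
Proof. exact: prxP. Qed.

Lemma prqD a b : prq (a + b) = prq a + prq b. Proof. exact: prxD. Qed.

Lemma prq_mul a b : quox_mul (prq a) (prq b) = prq (a * b).
Proof.
have /prqP[c Hc] := liftqK (prq a); have /prqP[e He] := liftqK (prq b).
apply/prqP; exists (c * liftq (prq b) + a * e).
rewrite mulrDr mulrA -Hc [x * (a * e)]mulrCA -He mulrBl mulrBr.
by rewrite addrA addrNK.
Qed.

Lemma quox_mulA : associative quox_mul.
Proof.
by move=> a b c; rewrite -(liftqK a) -(liftqK b) -(liftqK c) !prq_mul mulrA.
Qed.
Lemma quox_mulC : commutative quox_mul.
Proof. by move=> a b; rewrite -(liftqK a) -(liftqK b) !prq_mul mulrC. Qed.
Lemma quox_mul1 : left_id (prq 1) quox_mul.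
Proof. by move=> a; rewrite -(liftqK a) !prq_mul mul1r. Qed.
Lemma quox_mulDl : left_distributive quox_mul +%R.
Proof.
move=> a b c; rewrite -(liftqK a) -(liftqK b) -(liftqK c).
by rewrite -prqD !prq_mul mulrDl prqD.
Qed.
Lemma quox_mul0 : left_zero 0 quox_mul.
Proof.
move=> a; have := quox_mulDl 0 0 a; rewrite addr0 => /esym/eqP.
by rewrite -subr_eq0 addrK => /eqP.
Qed.
HB.instance Definition _ := GRing.Zmodule_isComPzRing.Build quox
  quox_mulA quox_mulC quox_mul1 quox_mulDl.

Lemma prq1 : prq 1 = 1. Proof. by []. Qed.
Lemma prqM a b : prq (a * b) = prq a * prq b.
Proof. by rewrite -prq_mul. Qed.

Definition modx_scale (F : lmodType S) (a : quox) (v : modx F) : modx F :=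
  prx (liftq a *: liftx v).

Lemma prx_scale (F : lmodType S) a (v : F) : modx_scale (prq a) (prx v) = prx (a *: v).
Proof.
have /prqP[c Hc] := liftqK (prq a); have /prxP[e He] := liftxK (prx v).
apply/prxP; exists (c *: liftx (prx v) + a *: e).
rewrite scalerDr scalerA -Hc scalerA mulrC -scalerA -He scalerBl scalerBr.
by rewrite addrA addrNK.
Qed.

Section Lmod.
Variable F : lmodType S.
Lemma modx_scaleA (a b : quox) (v : modx F) :
  modx_scale a (modx_scale b v) = modx_scale (a * b) v.
Proof.
rewrite -(liftqK a) -(liftqK b) -(liftxK v).
by rewrite -prqM !prx_scale scalerA.
Qed.
Lemma modx_scale1 : left_id 1 (@modx_scale F).
Proof. by move=> v; rewrite -(liftxK v) -prq1 prx_scale scale1r. Qed.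
Lemma modx_scaleDr : right_distributive (@modx_scale F) +%R.
Proof.
move=> a u v; rewrite -(liftqK a) -(liftxK u) -(liftxK v).
by rewrite -prxD !prx_scale scalerDr prxD.
Qed.
Lemma modx_scaleDl (v : modx F) : {morph (@modx_scale F)^~ v : a b / a + b}.
Proof.
move=> a b; rewrite -(liftqK a) -(liftqK b) -(liftxK v).
by rewrite -prqD !prx_scale scalerDl prxD.
Qed.
HB.instance Definition _ := GRing.Zmodule_isLmodule.Build quox (modx F)
  modx_scaleA modx_scale1 modx_scaleDr modx_scaleDl.
Lemma prxZ a (v : F) : prx (a *: v) = prq a *: prx v.
Proof. by rewrite -prx_scale. Qed.
End Lmod.

(* the map F / xF -> G / xG induced by f *)
Definition redx_fun (F G : lmodType S) (f : {linear F -> G}) (v : modx F) :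
  modx G := prx (f (liftx v)).

Lemma redx_funE (F G : lmodType S) (f : {linear F -> G}) v : redx_fun f (prx v) = prx (f v).
Proof.
have /prxP[w Hw] := liftxK (prx v).
by apply/prxP; exists (f w); rewrite -linearB Hw linearZ.
Qed.

Section Red.
Variables (F G : lmodType S) (f : {linear F -> G}).
Lemma redx_linear : linear (redx_fun f).
Proof.
move=> a u v; rewrite -(liftqK a) -(liftxK u) -(liftxK v).
by rewrite -prxZ -prxD !redx_funE linearP prxD prxZ.
Qed.
HB.instance Definition _ :=
  GRing.isLinear.Build quox (modx F) (modx G) _ (redx_fun f) redx_linear.
Definition redx : {linear modx F -> modx G} := redx_fun f.
Lemma redxE v : redx (prx v) = prx (f v).
Proof. exact: redx_funE. Qed.
End Red.

End ModX.


Section Modules.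
Variable R : pzRingType.
Implicit Types U V : lmodType R.

Definition mklin U V (f : U -> V) (fl : linear f) : {linear U -> V} :=
  HB.pack_for {linear U -> V} f (GRing.isLinear.Build R U V _ f fl).

Definition fg_free V : Prop :=
  exists n (f : {linear 'rV[R]_n -> V}), bijective f.

Definition fin_generated V : Prop :=
  exists n (e : 'I_n -> V),
    forall v, exists c : 'I_n -> R, v = \sum_(i < n) c i *: e i.

Definition projective V : Prop :=
  forall (M N : lmodType R) (p : {linear M -> N}) (f : {linear V -> N}),
    (forall y, exists z, p z = y) ->
    exists g : {linear V -> M}, forall v, p (g v) = f v.

Definition fg_projective V : Prop := fin_generated V /\ projective V.

Section Block.
Variables U1 U2 V1 V2 : lmodType R.
Variables (a : {linear U1 -> V1}) (b : {linear U2 -> V1}).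
Variables (c : {linear U1 -> V2}) (d : {linear U2 -> V2}).

(* the linear map U1 * U2 -> V1 * V2 with matrix [a b; c d], acting on columns *)
Definition blk_fun (u : U1 * U2) : V1 * V2 :=
  (a u.1 + b u.2, c u.1 + d u.2).
Lemma blk_linear : linear blk_fun.
Proof.
move=> k u v; rewrite /blk_fun; congr (_, _) => /=; rewrite !linearP.
  by rewrite scalerDr addrACA.
by rewrite scalerDr addrACA.
Qed.
HB.instance Definition _ :=
  GRing.isLinear.Build R (U1 * U2)%type (V1 * V2)%type _ blk_fun blk_linear.
Definition blk : {linear (U1 * U2)%type -> (V1 * V2)%type} := blk_fun.
End Block.

Section Inj.
Variables U V : lmodType R.
Definition inlm_fun (u : U) : U * V := (u, 0).
Definition inrm_fun (v : V) : U * V := (0, v).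
Lemma inlm_linear : linear inlm_fun.
Proof. by move=> k u v; congr (_, _); rewrite /= scaler0 addr0. Qed.
Lemma inrm_linear : linear inrm_fun.
Proof. by move=> k u v; congr (_, _); rewrite /= scaler0 addr0. Qed.
HB.instance Definition _ :=
  GRing.isLinear.Build R U (U * V)%type _ inlm_fun inlm_linear.
HB.instance Definition _ :=
  GRing.isLinear.Build R V (U * V)%type _ inrm_fun inrm_linear.
Definition inlm : {linear U -> (U * V)%type} := inlm_fun.
Definition inrm : {linear V -> (U * V)%type} := inrm_fun.
End Inj.

Lemma fg_free_prod U V : fg_free U -> fg_free V -> fg_free (U * V)%type.
Proof.
move=> [m [f [f' fK f'K]]] [n [g [g' gK g'K]]].
pose h (v : 'rV[R]_(m + n)) : U * V := (f (lsubmx v), g (rsubmx v)).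
have hl : linear h.
  by move=> k u v; congr (_, _); rewrite /= !linearP.
exists (m + n)%N.
exists (mklin hl).
exists (fun u => row_mx (f' u.1) (g' u.2)).
  by move=> v; rewrite /= fK gK hsubmxK.
by move=> [u v]; rewrite /= /h row_mxKl row_mxKr f'K g'K.
Qed.

Lemma fg_projective_prod U V :
  fg_projective U -> fg_projective V -> fg_projective (U * V)%type.
Proof.
move=> [[m [e eP]] Up] [[n [e' e'P]] Vp]; split.
  exists (m + n)%N, (fun i => match split i with
    | inl i => (e i, 0) | inr i => (0, e' i) end) => -[u v].
  have [c ->] := eP u; have [c' ->] := e'P v.
  exists (fun i => match split i with inl i => c i | inr i => c' i end).
  have El (i : 'I_m) : split (lshift n i) = inl i by exact: (unsplitK (inl i)).
  have Er (i : 'I_n) : split (rshift m i) = inr i by exact: (unsplitK (inr i)).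
  rewrite big_split_ord /=.
  rewrite (eq_bigr (fun i => inlm U V (c i *: e i))); last first.
    by move=> i _; rewrite El linearZ.
  rewrite [X in _ = _ + X](eq_bigr (fun i => inrm U V (c' i *: e' i))).
    rewrite -!linear_sum /= /inlm_fun /inrm_fun.
    by congr (_, _); rewrite /= ?addr0 ?add0r.
  by move=> i _; rewrite Er linearZ.
move=> M N p f ps.
have [g gP] := Up _ _ p (f \o inlm U V) ps.
have [k kP] := Vp _ _ p (f \o inrm U V) ps.
have hl : linear (fun u : U * V => g u.1 + k u.2).
  by move=> a u v; rewrite /= !linearP scalerDr addrACA.
exists (mklin hl).
move=> [u v] /=; rewrite linearD gP kP /= -linearD; congr (f _).
by congr (_, _); rewrite /= ?addr0 ?add0r.
Qed.

End Modules.

(* Categories whose equality of morphisms is an equivalence heq. A morphism of a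
   homotopy category is given by a representative of its homotopy class, and heq
   is the homotopy relation. *)
Record category := Category {
  ob :> Type;
  Mor : ob -> ob -> Type;
  heq : forall X Y, Mor X Y -> Mor X Y -> Prop;
  idm : forall X, Mor X X;
  cmp : forall X Y Z, Mor Y Z -> Mor X Y -> Mor X Z;
  heq_refl : forall X Y (f : Mor X Y), heq f f;
  heq_sym : forall X Y (f g : Mor X Y), heq f g -> heq g f;
  heq_trans : forall X Y (f g h : Mor X Y), heq f g -> heq g h -> heq f h;
  cmp_heq : forall X Y Z (g g' : Mor Y Z) (f f' : Mor X Y),
    heq g g' -> heq f f' -> heq (cmp g f) (cmp g' f');
  cmpA : forall X Y Z W (h : Mor Z W) (g : Mor Y Z) (f : Mor X Y),
    heq (cmp h (cmp g f)) (cmp (cmp h g) f);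
  cmp1m : forall X Y (f : Mor X Y), heq (cmp (idm Y) f) f;
  cmpm1 : forall X Y (f : Mor X Y), heq (cmp f (idm X)) f }.

Arguments Mor {c} X Y.
Arguments heq {c X Y} f g.
Arguments idm {c} X.
Arguments cmp {c X Y Z} g f.

Declare Scope cat_scope.
Delimit Scope cat_scope with cat.
Notation "f ~= g" := (heq f g) (at level 70) : cat_scope.
Notation "g \c f" := (cmp g f) (at level 50, left associativity) : cat_scope.
Local Open Scope cat_scope.

Record preadditive := Preadditive {
  pre_cat :> category;
  hzero : forall X Y : pre_cat, Mor X Y;
  hopp : forall X Y : pre_cat, Mor X Y -> Mor X Y;
  hadd : forall X Y : pre_cat, Mor X Y -> Mor X Y -> Mor X Y;
  hadd_heq : forall X Y (f f' g g' : Mor X Y),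
    f ~= f' -> g ~= g' -> hadd f g ~= hadd f' g';
  haddA : forall X Y (f g h : Mor X Y), hadd f (hadd g h) ~= hadd (hadd f g) h;
  haddC : forall X Y (f g : Mor X Y), hadd f g ~= hadd g f;
  hadd0 : forall X Y (f : Mor X Y), hadd (hzero X Y) f ~= f;
  haddN : forall X Y (f : Mor X Y), hadd (hopp f) f ~= hzero X Y;
  cmpDl : forall X Y Z (g g' : Mor Y Z) (f : Mor X Y),
    hadd g g' \c f ~= hadd (g \c f) (g' \c f);
  cmpDr : forall X Y Z (g : Mor Y Z) (f f' : Mor X Y),
    g \c hadd f f' ~= hadd (g \c f) (g \c f') }.

Arguments hzero {p} X Y.
Arguments hopp {p X Y} f.
Arguments hadd {p X Y} f g.

Definition is_iso (C : category) (X Y : C) (f : Mor X Y) : Prop :=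
  exists g : Mor Y X, g \c f ~= idm X /\ f \c g ~= idm Y.

Definition additive_functor (C D : preadditive) (T0 : C -> D)
    (T1 : forall X Y, Mor X Y -> Mor (T0 X) (T0 Y)) : Prop :=
  [/\ forall X Y (f f' : Mor X Y), f ~= f' -> T1 X Y f ~= T1 X Y f',
      forall X, T1 X X (idm X) ~= idm (T0 X),
      forall X Y Z (g : Mor Y Z) (f : Mor X Y),
        T1 X Z (g \c f) ~= T1 Y Z g \c T1 X Y f
    & forall X Y (f f' : Mor X Y),
        T1 X Y (hadd f f') ~= hadd (T1 X Y f) (T1 X Y f')].

Definition full_functor (C D : category) (T0 : C -> D)
    (T1 : forall X Y, Mor X Y -> Mor (T0 X) (T0 Y)) : Prop :=
  forall X Y (g : Mor (T0 X) (T0 Y)), exists f : Mor X Y, T1 X Y f ~= g.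

Definition faithful_functor (C D : category) (T0 : C -> D)
    (T1 : forall X Y, Mor X Y -> Mor (T0 X) (T0 Y)) : Prop :=
  forall X Y (f f' : Mor X Y), T1 X Y f ~= T1 X Y f' -> f ~= f'.

Record suspended := Suspended {
  susp_cat :> preadditive;
  susp : susp_cat -> susp_cat;
  suspm : forall X Y, Mor X Y -> Mor (susp X) (susp Y);
  susp_functor : additive_functor suspm }.

Arguments susp {s} X.
Arguments suspm {s X Y} f.

Definition triangle_iso (C : suspended) (X Y Z X' Y' Z' : C)
    (u : Mor X Y) (v : Mor Y Z) (w : Mor Z (susp X))
    (u' : Mor X' Y') (v' : Mor Y' Z') (w' : Mor Z' (susp X')) : Prop :=
  exists (a : Mor X X') (b : Mor Y Y') (c : Mor Z Z'),
    [/\ is_iso a, is_iso b & is_iso c] /\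
    [/\ b \c u ~= u' \c a, c \c v ~= v' \c b & suspm a \c w ~= w' \c c].

(* The data of a triangulated category, which is all that the notion of triangle
   functor refers to; the axioms of triangulated categories are not included. *)
Record tri_category := TriCategory {
  tri_cat :> suspended;
  distinguished : forall X Y Z : tri_cat,
    Mor X Y -> Mor Y Z -> Mor Z (susp X) -> Prop }.

Arguments distinguished {t X Y Z} u v w.

Definition triangle_functor (C D : tri_category) (T0 : C -> D)
    (T1 : forall X Y, Mor X Y -> Mor (T0 X) (T0 Y)) : Prop :=
  additive_functor T1 /\
  exists eta : forall X, Mor (T0 (susp X)) (susp (T0 X)),
    [/\ forall X, is_iso (eta X),
        forall X Y (f : Mor X Y),
          eta Y \c T1 _ _ (suspm f) ~= suspm (T1 _ _ f) \c eta X
      & forall X Y Z (u : Mor X Y) (v : Mor Y Z) (w : Mor Z (susp X)),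
          distinguished u v w ->
          distinguished (T1 _ _ u) (T1 _ _ v) (eta X \c T1 _ _ w)].

Section MatrixFactorizations.
Variables (S : comPzRingType) (x : S).

Record mf := MF {
  mfF : lmodType S;
  mfG : lmodType S;
  mf_phi : {linear mfF -> mfG};
  mf_psi : {linear mfG -> mfF};
  mfF_free : fg_free mfF;
  mfG_free : fg_free mfG;
  mf_psiphi : forall v, mf_psi (mf_phi v) = x *: v;
  mf_phipsi : forall v, mf_phi (mf_psi v) = x *: v }.

Record mf_hom (M N : mf) := MFHom {
  mf_f : {linear mfF M -> mfF N};
  mf_g : {linear mfG M -> mfG N};
  mf_comm_phi : forall v, mf_g (mf_phi M v) = mf_phi N (mf_f v);
  mf_comm_psi : forall v, mf_f (mf_psi M v) = mf_psi N (mf_g v) }.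

Definition mf_htpy (M N : mf) (h h' : mf_hom M N) : Prop :=
  exists (s : {linear mfG M -> mfF N}) (t : {linear mfF M -> mfG N}),
    (forall v, mf_f h v - mf_f h' v = s (mf_phi M v) + mf_psi N (t v)) /\
    (forall v, mf_g h v - mf_g h' v = t (mf_psi M v) + mf_phi N (s v)).

Lemma mf_htpy_eq M N (h h' : mf_hom M N) :
  (forall v, mf_f h v = mf_f h' v) -> (forall v, mf_g h v = mf_g h' v) ->
  mf_htpy h h'.
Proof.
move=> ef eg; exists \0, \0.
by split=> v; rewrite (ef, eg) subrr /= linear0 addr0.
Qed.

Lemma mf_htpy_refl M N (h : mf_hom M N) : mf_htpy h h.
Proof. exact: mf_htpy_eq. Qed.

Lemma mf_htpy_sym M N (h h' : mf_hom M N) : mf_htpy h h' -> mf_htpy h' h.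
Proof.
move=> [s [t [hf hg]]]; exists (\- s), (\- t); split=> v.
  by rewrite -opprB hf /= linearN opprD.
by rewrite -opprB hg /= linearN opprD.
Qed.

Lemma mf_htpy_trans M N (h h' h'' : mf_hom M N) :
  mf_htpy h h' -> mf_htpy h' h'' -> mf_htpy h h''.
Proof.
move=> [s [t [hf hg]]] [s' [t' [hf' hg']]].
exists (s \+ s'), (t \+ t'); split=> v /=.
  by rewrite [mf_psi N _]linearD addrACA -hf -hf' addrA subrK.
by rewrite [mf_phi N _]linearD addrACA -hg -hg' addrA subrK.
Qed.

Definition mf_id M : mf_hom M M :=
  @MFHom M M idfun idfun (fun=> erefl) (fun=> erefl).

Lemma mf_cmp_phi M N P (k : mf_hom N P) (h : mf_hom M N) v :
  mf_g k (mf_g h (mf_phi M v)) = mf_phi P (mf_f k (mf_f h v)).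
Proof. by rewrite !mf_comm_phi. Qed.
Lemma mf_cmp_psi M N P (k : mf_hom N P) (h : mf_hom M N) v :
  mf_f k (mf_f h (mf_psi M v)) = mf_psi P (mf_g k (mf_g h v)).
Proof. by rewrite !mf_comm_psi. Qed.
Definition mf_cmp M N P (k : mf_hom N P) (h : mf_hom M N) : mf_hom M P :=
  @MFHom M P (mf_f k \o mf_f h) (mf_g k \o mf_g h)
    (mf_cmp_phi k h) (mf_cmp_psi k h).

Lemma mf_cmp_htpy M N P (k k' : mf_hom N P) (h h' : mf_hom M N) :
  mf_htpy k k' -> mf_htpy h h' -> mf_htpy (mf_cmp k h) (mf_cmp k' h').
Proof.
move=> [s' [t' [hf' hg']]] [s [t [hf hg]]].
exists ((mf_f k \o s) \+ (s' \o mf_g h')), ((mf_g k \o t) \+ (t' \o mf_f h')).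
split=> v /=.
  rewrite [mf_psi P _]linearD -mf_comm_psi mf_comm_phi addrACA -hf' -linearD -hf.
  by rewrite linearB addrA subrK.
rewrite [mf_phi P _]linearD -mf_comm_phi mf_comm_psi addrACA -hg' -linearD -hg.
by rewrite linearB addrA subrK.
Qed.

Definition mf_cat : category := {|
  ob := mf; Mor := mf_hom; heq := mf_htpy; idm := mf_id; cmp := mf_cmp;
  heq_refl := mf_htpy_refl; heq_sym := mf_htpy_sym; heq_trans := mf_htpy_trans;
  cmp_heq := mf_cmp_htpy;
  cmpA := fun M N P Q h g f =>
    mf_htpy_refl (mf_cmp h (mf_cmp g f));
  cmp1m := fun M N f => @mf_htpy_eq M N (mf_cmp (mf_id N) f) f
    (fun=> erefl) (fun=> erefl);
  cmpm1 := fun M N f => @mf_htpy_eq M N (mf_cmp f (mf_id M)) f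
    (fun=> erefl) (fun=> erefl) |}.

Section Additive.
Variables M N : mf.
Implicit Types h : mf_hom M N.

Lemma mf_zero_phi (v : mfF M) :
  (\0 : mfG M -> mfG N) (mf_phi M v) = mf_phi N ((\0 : mfF M -> mfF N) v).
Proof. by rewrite /= linear0. Qed.
Lemma mf_zero_psi (v : mfG M) :
  (\0 : mfF M -> mfF N) (mf_psi M v) = mf_psi N ((\0 : mfG M -> mfG N) v).
Proof. by rewrite /= linear0. Qed.
Definition mf_zero : mf_hom M N := @MFHom M N \0 \0 mf_zero_phi mf_zero_psi.

Lemma mf_opp_phi h v : - mf_g h (mf_phi M v) = mf_phi N (- mf_f h v).
Proof. by rewrite mf_comm_phi linearN. Qed.
Lemma mf_opp_psi h v : - mf_f h (mf_psi M v) = mf_psi N (- mf_g h v).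
Proof. by rewrite mf_comm_psi linearN. Qed.
Definition mf_opp h : mf_hom M N :=
  @MFHom M N (\- mf_f h) (\- mf_g h) (mf_opp_phi h) (mf_opp_psi h).

Lemma mf_add_phi h h' v :
  mf_g h (mf_phi M v) + mf_g h' (mf_phi M v) = mf_phi N (mf_f h v + mf_f h' v).
Proof. by rewrite !mf_comm_phi linearD. Qed.
Lemma mf_add_psi h h' v :
  mf_f h (mf_psi M v) + mf_f h' (mf_psi M v) = mf_psi N (mf_g h v + mf_g h' v).
Proof. by rewrite !mf_comm_psi linearD. Qed.
Definition mf_add h h' : mf_hom M N :=
  @MFHom M N (mf_f h \+ mf_f h') (mf_g h \+ mf_g h')
    (mf_add_phi h h') (mf_add_psi h h').

Lemma mf_add_htpy h1 h1' h2 h2' :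
  mf_htpy h1 h1' -> mf_htpy h2 h2' -> mf_htpy (mf_add h1 h2) (mf_add h1' h2').
Proof.
move=> [s [t [hf hg]]] [s' [t' [hf' hg']]].
exists (s \+ s'), (t \+ t'); split=> v /=.
  by rewrite [mf_psi N _]linearD [RHS]addrACA -hf -hf' opprD addrACA.
by rewrite [mf_phi N _]linearD [RHS]addrACA -hg -hg' opprD addrACA.
Qed.

End Additive.

Definition mf_preadditive : preadditive.
Proof.
refine (@Preadditive mf_cat mf_zero mf_opp mf_add mf_add_htpy _ _ _ _ _ _).
- by move=> M N f g h; apply: mf_htpy_eq => v /=; rewrite addrA.
- by move=> M N f g; apply: mf_htpy_eq => v /=; rewrite addrC.
- by move=> M N f; apply: mf_htpy_eq => v /=; rewrite add0r.
- by move=> M N f; apply: mf_htpy_eq => v /=; rewrite addNr.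
- by move=> M N P g g' f; apply: mf_htpy_eq.
- by move=> M N P g f f'; apply: mf_htpy_eq => v /=; rewrite linearD.
Defined.

Lemma mf_susp_psiphi M v : - mf_phi M (- mf_psi M v) = x *: v.
Proof. by rewrite linearN opprK mf_phipsi. Qed.
Lemma mf_susp_phipsi M v : - mf_psi M (- mf_phi M v) = x *: v.
Proof. by rewrite linearN opprK mf_psiphi. Qed.
Definition mf_susp (M : mf) : mf :=
  @MF (mfG M) (mfF M) (\- mf_psi M) (\- mf_phi M) (mfG_free M) (mfF_free M)
    (@mf_susp_psiphi M) (@mf_susp_phipsi M).

Lemma mf_suspm_phi M N (h : mf_hom M N) v :
  mf_f h (- mf_psi M v) = - mf_psi N (mf_g h v).
Proof. by rewrite linearN mf_comm_psi. Qed.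
Lemma mf_suspm_psi M N (h : mf_hom M N) v :
  mf_g h (- mf_phi M v) = - mf_phi N (mf_f h v).
Proof. by rewrite linearN mf_comm_phi. Qed.
Definition mf_suspm M N (h : mf_hom M N) : mf_hom (mf_susp M) (mf_susp N) :=
  @MFHom (mf_susp M) (mf_susp N) (mf_g h) (mf_f h)
    (mf_suspm_phi h) (mf_suspm_psi h).

Lemma mf_suspm_functor :
  @additive_functor mf_preadditive mf_preadditive mf_susp mf_suspm.
Proof.
split.
- move=> M N h h' [s [t [hf hg]]]; exists (\- t), (\- s).
  by split=> v /=; rewrite !linearN !opprK (hf, hg).
- by move=> M; apply: mf_htpy_eq.
- by move=> M N P g f; apply: mf_htpy_eq.
- by move=> M N f g; apply: mf_htpy_eq.
Qed.

Definition mf_suspended : suspended := Suspended mf_suspm_functor.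

Section Cone.
Variables (M N : mf) (h : mf_hom M N).

Definition mf_cone_phi :
    {linear (mfG M * mfF N)%type -> (mfF M * mfG N)%type} :=
  blk (\- mf_psi M) \0 (mf_g h) (mf_phi N).
Definition mf_cone_psi :
    {linear (mfF M * mfG N)%type -> (mfG M * mfF N)%type} :=
  blk (\- mf_phi M) \0 (mf_f h) (mf_psi N).

Lemma mf_cone_psiphi v : mf_cone_psi (mf_cone_phi v) = x *: v.
Proof.
case: v => a b; congr (_, _) => /=; rewrite !addr0 linearN.
  by rewrite opprK mf_phipsi.
by rewrite linearD -mf_comm_psi mf_psiphi addKr.
Qed.
Lemma mf_cone_phipsi v : mf_cone_phi (mf_cone_psi v) = x *: v.
Proof.
case: v => a b; congr (_, _) => /=; rewrite !addr0 linearN.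
  by rewrite opprK mf_psiphi.
by rewrite linearD -mf_comm_phi mf_phipsi addKr.
Qed.
Definition mf_cone : mf :=
  @MF _ _ mf_cone_phi mf_cone_psi
    (fg_free_prod (mfG_free M) (mfF_free N))
    (fg_free_prod (mfF_free M) (mfG_free N))
    mf_cone_psiphi mf_cone_phipsi.

Lemma mf_cone_incl_phi v :
  inrm (mfF M) (mfG N) (mf_phi N v) =
  mf_cone_phi (inrm (mfG M) (mfF N) v).
Proof. by congr (_, _) => /=; rewrite linear0 ?oppr0 ?addr0 ?add0r. Qed.
Lemma mf_cone_incl_psi v :
  inrm (mfG M) (mfF N) (mf_psi N v) =
  mf_cone_psi (inrm (mfF M) (mfG N) v).
Proof. by congr (_, _) => /=; rewrite linear0 ?oppr0 ?addr0 ?add0r. Qed.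
Definition mf_cone_incl : mf_hom N mf_cone :=
  @MFHom N mf_cone (inrm _ _) (inrm _ _) mf_cone_incl_phi mf_cone_incl_psi.

Lemma mf_cone_proj_phi (v : mfF mf_cone) :
  (mf_phi mf_cone v).1 = mf_phi (mf_susp M) v.1.
Proof. by rewrite /= addr0. Qed.
Lemma mf_cone_proj_psi (v : mfG mf_cone) :
  (mf_psi mf_cone v).1 = mf_psi (mf_susp M) v.1.
Proof. by rewrite /= addr0. Qed.
Definition mf_cone_proj : mf_hom mf_cone (mf_susp M) :=
  @MFHom mf_cone (mf_susp M) fst fst mf_cone_proj_phi mf_cone_proj_psi.

End Cone.

Definition mf_distinguished (X Y Z : mf_suspended)
    (u : Mor X Y) (v : Mor Y Z) (w : Mor Z (susp X)) : Prop :=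
  exists (M N : mf) (h : mf_hom M N),
    @triangle_iso mf_suspended X Y Z M N (mf_cone h)
      u v w h (mf_cone_incl h) (mf_cone_proj h).

Definition HMF : tri_category := TriCategory mf_distinguished.

End MatrixFactorizations.

Section Complexes.
Variable R : comPzRingType.

(* Homological grading: the differential cx_d i j is nonzero only for i = j + 1.
   Having one map for each pair of degrees avoids casts along n + 1 - 1 = n. *)
Record complex := Complex {
  cx_ob :> int -> lmodType R;
  cx_d : forall i j, {linear cx_ob i -> cx_ob j};
  cx_shape : forall i j, i != j + 1 -> forall v, cx_d i j v = 0;
  cx_dd : forall i j k v, cx_d j k (cx_d i j v) = 0 }.

Definition acyclic (C : complex) : Prop :=
  forall i j k, i = j + 1 -> j = k + 1 ->
  forall v : C j, cx_d C j k v = 0 -> exists u : C i, cx_d C i j u = v.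

(* acyclicity of the complex Hom_R(C, R) *)
Definition dual_acyclic (C : complex) : Prop :=
  forall i j k, i = j + 1 -> j = k + 1 ->
  forall p : {linear C j -> R^o}, (forall v, p (cx_d C i j v) = 0) ->
  exists q : {linear C k -> R^o}, forall v, q (cx_d C j k v) = p v.

Definition totally_acyclic (C : complex) : Prop :=
  [/\ forall n, fg_projective (C n), acyclic C & dual_acyclic C].

Record tac_complex := Tac {
  tac_cx :> complex;
  tacP : totally_acyclic tac_cx }.

Record chain_map (C D : complex) := ChainMap {
  cm_fun :> forall i, {linear C i -> D i};
  cm_comm : forall i j v, cm_fun j (cx_d C i j v) = cx_d D i j (cm_fun i v) }.

Definition homotopic (C D : complex) (f g : chain_map C D) : Prop :=
  exists h : forall i j, {linear C i -> D j},
    forall i j k, i = j + 1 -> j = k + 1 ->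
    forall v, f j v - g j v = cx_d D i j (h j i v) + h k j (cx_d C j k v).

Lemma homotopic_eq C D (f g : chain_map C D) :
  (forall i v, f i v = g i v) -> homotopic f g.
Proof.
move=> fg; exists (fun i j => \0) => i j k _ _ v.
by rewrite fg subrr /= linear0 addr0.
Qed.

Lemma homotopic_refl C D (f : chain_map C D) : homotopic f f.
Proof. exact: homotopic_eq. Qed.

Lemma homotopic_sym C D (f g : chain_map C D) :
  homotopic f g -> homotopic g f.
Proof.
move=> [h hP]; exists (fun i j => \- h i j) => i j k ij jk v.
by rewrite -opprB (hP i j k) //= linearN opprD.
Qed.

Lemma homotopic_trans C D (f g k : chain_map C D) :
  homotopic f g -> homotopic g k -> homotopic f k.
Proof.
move=> [h hP] [h' hP']; exists (fun i j => h i j \+ h' i j) => i j l ij jl v /=.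
rewrite [cx_d D i j _]linearD addrACA -(hP i j l) // -(hP' i j l) //.
by rewrite addrA subrK.
Qed.

Definition cm_id C : chain_map C C :=
  @ChainMap C C (fun i => idfun) (fun _ _ _ => erefl).

Lemma cm_cmp_comm C D E (g : chain_map D E) (f : chain_map C D) i j v :
  g j (f j (cx_d C i j v)) = cx_d E i j (g i (f i v)).
Proof. by rewrite !cm_comm. Qed.
Definition cm_cmp C D E (g : chain_map D E) (f : chain_map C D) :
    chain_map C E :=
  @ChainMap C E (fun i => g i \o f i) (cm_cmp_comm g f).

Lemma cm_cmp_homotopic C D E (g g' : chain_map D E) (f f' : chain_map C D) :
  homotopic g g' -> homotopic f f' -> homotopic (cm_cmp g f) (cm_cmp g' f').
Proof.
move=> [h' hP'] [h hP].
exists (fun i j => (g j \o h i j) \+ (h' i j \o f' i)) => i j k ij jk v /=.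
rewrite [cx_d E i j _]linearD -cm_comm [f' k _]cm_comm addrACA -(hP' i j k) //.
by rewrite -linearD -(hP i j k) // linearB addrA subrK.
Qed.

Section ChainAdd.
Variables C D : complex.
Implicit Types f g : chain_map C D.

Lemma cm_zero_comm i j (v : C i) :
  (\0 : C j -> D j) (cx_d C i j v) = cx_d D i j ((\0 : C i -> D i) v).
Proof. by rewrite /= linear0. Qed.
Definition cm_zero : chain_map C D :=
  @ChainMap C D (fun i => \0) cm_zero_comm.

Lemma cm_opp_comm f i j v : - f j (cx_d C i j v) = cx_d D i j (- f i v).
Proof. by rewrite cm_comm linearN. Qed.
Definition cm_opp f : chain_map C D :=
  @ChainMap C D (fun i => \- f i) (cm_opp_comm f).

Lemma cm_add_comm f g i j v :
  f j (cx_d C i j v) + g j (cx_d C i j v) = cx_d D i j (f i v + g i v).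
Proof. by rewrite !cm_comm linearD. Qed.
Definition cm_add f g : chain_map C D :=
  @ChainMap C D (fun i => f i \+ g i) (cm_add_comm f g).

Lemma cm_add_homotopic f f' g g' :
  homotopic f f' -> homotopic g g' -> homotopic (cm_add f g) (cm_add f' g').
Proof.
move=> [h hP] [h' hP']; exists (fun i j => h i j \+ h' i j) => i j k ij jk v /=.
rewrite [cx_d D i j _]linearD [RHS]addrACA -(hP i j k) // -(hP' i j k) //.
by rewrite opprD addrACA.
Qed.
End ChainAdd.

Section Shift.
Variable C : complex.

Lemma shift_shape i j :
  i != j + 1 -> forall v, - cx_d C (i - 1) (j - 1) v = 0.
Proof. by move=> ij v; rewrite cx_shape ?oppr0 //; lia. Qed.
Lemma shift_dd i j k v :
  - cx_d C (j - 1) (k - 1) (- cx_d C (i - 1) (j - 1) v) = 0.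
Proof. by rewrite linearN cx_dd !oppr0. Qed.
Definition shift : complex :=
  @Complex (fun i => C (i - 1)) (fun i j => \- cx_d C (i - 1) (j - 1))
    shift_shape shift_dd.

End Shift.

Lemma shift_tac C : totally_acyclic C -> totally_acyclic (shift C).
Proof.
case=> Cp Ca Cd; split=> [n|i j k ij jk v /= /eqP|i j k ij jk p pd].
- exact: Cp.
- rewrite oppr_eq0 => /eqP dv.
  have [] := Ca (i - 1) (j - 1) (k - 1) _ _ v dv; try lia.
  by move=> u <-; exists (- u); rewrite /= linearN opprK.
- have [] := Cd (i - 1) (j - 1) (k - 1) _ _ p; try lia.
    by move=> v; have := pd (- v); rewrite /= !linearN opprK.
  by move=> q qP; exists (\- q) => v /=; rewrite linearN opprK.
Qed.

Lemma shift_map_comm C D (f : chain_map C D) i j v :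
  f (j - 1) (- cx_d C (i - 1) (j - 1) v) =
  - cx_d D (i - 1) (j - 1) (f (i - 1) v).
Proof. by rewrite linearN cm_comm. Qed.
Definition shift_map C D (f : chain_map C D) :
    chain_map (shift C) (shift D) :=
  @ChainMap (shift C) (shift D) (fun i => f (i - 1)) (shift_map_comm f).

(* the identity map from degree i to degree j if i = j, and 0 otherwise *)
Section Cast.
Variables (D : int -> lmodType R) (i j : int).
Definition castm_fun (v : D i) : D j :=
  if i =P j is ReflectT e then ecast k (D k) e v else 0.
Lemma castm_linear : linear castm_fun.
Proof.
rewrite /castm_fun; case: eqP => [e|_ a u v]; last by rewrite scaler0 addr0.
by case: _ / e.
Qed.
HB.instance Definition _ :=
  GRing.isLinear.Build R (D i) (D j) _ castm_fun castm_linear.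
Definition castm : {linear D i -> D j} := castm_fun.
End Cast.

Lemma castm_id D i v : castm D i i v = v.
Proof.
rewrite /castm /= /castm_fun; case: eqP => // e.
by rewrite (eq_irrelevance e erefl).
Qed.

Lemma castm_ne D i j v : i != j -> castm D i j v = 0.
Proof. by rewrite /castm /= /castm_fun; case: eqP. Qed.

Lemma castm_d (D : complex) i i' j j' v :
  i = i' -> j = j' ->
  cx_d D i' j' (castm D i i' v) = castm D j j' (cx_d D i j v).
Proof. by move=> <- <-; rewrite !castm_id. Qed.

Section Cone.
Variables (C D : complex) (f : chain_map C D).

Definition cone_ob (i : int) : lmodType R := (C (i - 1) * D i)%type.
(* [-d_C 0; f d_D]; f : C (i - 1) -> D (i - 1) has to be read in degree j *)
Definition cone_d i j : {linear cone_ob i -> cone_ob j} :=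
  blk (\- cx_d C (i - 1) (j - 1)) \0
      (castm D (i - 1) j \o f (i - 1)) (cx_d D i j).

Lemma cone_shape i j : i != j + 1 -> forall v, cone_d i j v = 0.
Proof.
move=> ij [a b]; congr (_, _) => /=.
  by rewrite cx_shape ?oppr0 ?addr0 //; lia.
by rewrite castm_ne ?cx_shape ?addr0 //; lia.
Qed.
Lemma cone_dd i j k v : cone_d j k (cone_d i j v) = 0.
Proof.
have [ij|/cone_shape ->] := eqVneq i (j + 1); last by rewrite linear0.
have [jk|/cone_shape -> //] := eqVneq j (k + 1).
case: v => a b; congr (_, _) => /=; rewrite ?addr0.
  by rewrite linearN cx_dd !oppr0.
rewrite linearD cx_dd addr0 (castm_d (j := j - 1)); [|lia..].
by rewrite !linearN -cm_comm addNr.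
Qed.
Definition cone : complex := @Complex cone_ob cone_d cone_shape cone_dd.

Lemma cone_tac : totally_acyclic C -> totally_acyclic D -> totally_acyclic cone.
Proof.
case=> Cp Ca Cd [Dp Da Dd]; split=> [n|i j k ij jk [a b]|i j k ij jk p pd].
- exact: fg_projective_prod.
- case=> /= /eqP; rewrite addr0 oppr_eq0 => /eqP da fd.
  have [] := Ca (i - 1) (j - 1) (k - 1) _ _ a da; try lia.
  move=> a' a'P.
  pose c := castm D (i - 1) j (f (i - 1) a').
  have [] := Da i j k ij jk (b + c).
    rewrite linearD /c (castm_d (j := j - 1)); try lia.
    by rewrite -cm_comm a'P addrC.
  move=> b' b'P.
  exists (- a', b'); congr (_, _) => /=; first by rewrite addr0 linearN opprK.
  by rewrite !linearN b'P addrC addrK.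
- pose pl a := p (inlm (C (j - 1)) (D j) a).
  pose pr b := p (inrm (C (j - 1)) (D j) b).
  have pE a b : p (a, b) = pl a + pr b.
    by rewrite -linearD; congr (p (_, _)); rewrite /= ?addr0 ?add0r.
  have [] := Dd i j k ij jk (p \o inrm (C (j - 1)) (D j)).
    move=> b; have := pd (0, b); congr (_ = _); congr (p (_, _)) => /=.
      by rewrite linear0 oppr0 addr0.
    by rewrite !linear0 add0r.
  move=> q' q'P.
  have [] := Cd (i - 1) (j - 1) (k - 1) _ _
    ((p \o inlm (C (j - 1)) (D j)) \- (q' \o (castm D (j - 1) k \o f (j - 1))));
    try lia.
    move=> a; have := pd (- a, 0); rewrite /= pE.
    rewrite /pr -[p _]q'P /= addr0 !linearN /= opprK linear0 addr0 linearN.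
    rewrite (castm_d (j := j - 1)); try lia.
    by rewrite -cm_comm [q' (- _)]linearN.
  move=> p' p'P.
  exists (((\- p') \o fst) \+ (q' \o snd)) => -[a b] /=.
  rewrite addr0 linearN opprK p'P [q' (_ + _)]linearD q'P pE /=.
  by rewrite addrA subrK.
Qed.

Lemma cone_incl_comm i j v :
  inrm (C (j - 1)) (D j) (cx_d D i j v) =
  cx_d cone i j (inrm (C (i - 1)) (D i) v).
Proof. by congr (_, _) => /=; rewrite !linear0 ?oppr0 ?addr0 ?add0r. Qed.
Definition cone_incl : chain_map D cone :=
  @ChainMap D cone (fun i => inrm (C (i - 1)) (D i)) cone_incl_comm.

Lemma cone_proj_comm i j (v : cone i) :
  (cx_d cone i j v).1 = cx_d (shift C) i j v.1.
Proof. by rewrite /= addr0. Qed.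
Definition cone_proj : chain_map cone (shift C) :=
  @ChainMap cone (shift C) (fun i => fst) cone_proj_comm.

End Cone.

Definition tac_cat : category := {|
  ob := tac_complex;
  Mor := fun C D => chain_map C D;
  heq := fun C D f g => homotopic f g;
  idm := fun C => cm_id C;
  cmp := fun C D E g f => cm_cmp g f;
  heq_refl := fun C D f => homotopic_refl f;
  heq_sym := fun C D f g => @homotopic_sym C D f g;
  heq_trans := fun C D f g h => @homotopic_trans C D f g h;
  cmp_heq := fun C D E g g' f f' => @cm_cmp_homotopic C D E g g' f f';
  cmpA := fun C D E F h g f => homotopic_refl (cm_cmp h (cm_cmp g f));
  cmp1m := fun C D f => @homotopic_eq C D (cm_cmp (cm_id D) f) f
    (fun _ _ => erefl);
  cmpm1 := fun C D f => @homotopic_eq C D (cm_cmp f (cm_id C)) f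
    (fun _ _ => erefl) |}.

Definition tac_preadditive : preadditive.
Proof.
refine (@Preadditive tac_cat (fun C D => cm_zero C D)
  (fun C D f => cm_opp f) (fun C D f g => cm_add f g)
  (fun C D f f' g g' => @cm_add_homotopic C D f f' g g') _ _ _ _ _ _).
- by move=> C D f g h; apply: homotopic_eq => i v /=; rewrite addrA.
- by move=> C D f g; apply: homotopic_eq => i v /=; rewrite addrC.
- by move=> C D f; apply: homotopic_eq => i v /=; rewrite add0r.
- by move=> C D f; apply: homotopic_eq => i v /=; rewrite addNr.
- by move=> C D E g g' f; apply: homotopic_eq.
- by move=> C D E g f f'; apply: homotopic_eq => i v /=; rewrite linearD.
Defined.

Definition tac_shift (C : tac_complex) : tac_complex := Tac (shift_tac (tacP C)).

Lemma shift_map_functor :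
  @additive_functor tac_preadditive tac_preadditive tac_shift
    (fun C D f => shift_map f).
Proof.
split.
- move=> C D f g [h hP].
  exists (fun i j => \- h (i - 1) (j - 1)) => i j k ij jk v /=.
  by rewrite !linearN !opprK (hP (i - 1) _ (k - 1)) //; lia.
- by move=> C; apply: homotopic_eq.
- by move=> C D E g f; apply: homotopic_eq.
- by move=> C D f g; apply: homotopic_eq.
Qed.

Definition tac_suspended : suspended := Suspended shift_map_functor.

Definition tac_cone (C D : tac_complex) (f : chain_map C D) : tac_complex :=
  Tac (cone_tac f (tacP C) (tacP D)).

Definition tac_distinguished (X Y Z : tac_suspended)
    (u : Mor X Y) (v : Mor Y Z) (w : Mor Z (susp X)) : Prop :=
  exists (C D : tac_complex) (f : chain_map C D),
    @triangle_iso tac_suspended X Y Z C D (tac_cone f)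
      u v w f (cone_incl f) (cone_proj f).

Definition Ktac : tri_category := TriCategory tac_distinguished.

End Complexes.

Section Reduction.
Variables (S : comPzRingType) (x : S).

(* F / xF sits in even degrees and G / xG in odd degrees *)
Definition parity (n : int) : bool := odd `|n|%N.

Lemma parityS n : parity (n + 1) = ~~ parity n.
Proof. by rewrite /parity; lia. Qed.

Section Objects.
Variable M : mf x.

Definition mf_mod (b : bool) : lmodType S := if b then mfG M else mfF M.

Definition mf_diff (b c : bool) : {linear mf_mod b -> mf_mod c} :=
  match b, c with
  | false, true => mf_phi M
  | true, false => mf_psi M
  | _, _ => \0
  end.

Definition mf_cx_ob (n : int) : lmodType (quox x) := modx x (mf_mod (parity n)).

Definition mf_cx_d (i j : int) : {linear mf_cx_ob i -> mf_cx_ob j} :=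
  if i == j + 1 then redx x (mf_diff (parity i) (parity j)) else \0.

Lemma mf_cx_shape i j : i != j + 1 -> forall v, mf_cx_d i j v = 0.
Proof. by rewrite /mf_cx_d => /negPf ->. Qed.

Lemma mf_cx_dd i j k v : mf_cx_d j k (mf_cx_d i j v) = 0.
Proof.
rewrite /mf_cx_d; case: (j =P k + 1) => // _.
case: (i =P j + 1) => _; last by rewrite linear0.
rewrite -(liftxK v) !redxE -prx0; apply/prxP.
case: (parity i) (parity j) (parity k) (liftx v) => [] [] [] w;
  rewrite /= subr0 ?linear0 ?mf_phipsi ?mf_psiphi;
  by [eexists | exists 0; rewrite scaler0].
Qed.

Definition mf_complex : complex (quox x) :=
  @Complex _ mf_cx_ob mf_cx_d mf_cx_shape mf_cx_dd.
End Objects.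

Section Morphisms.
Variables (M N : mf x) (h : mf_hom M N).

Definition mf_comp (b : bool) : {linear mf_mod M b -> mf_mod N b} :=
  if b is true then mf_g h else mf_f h.

Lemma mf_complex_map_comm i j v :
  redx x (mf_comp (parity j)) (mf_cx_d M i j v) =
  mf_cx_d N i j (redx x (mf_comp (parity i)) v).
Proof.
rewrite /mf_cx_d; case: eqP => [_|_]; last by rewrite linear0.
rewrite -(liftxK v); move: (liftx v); rewrite /mf_cx_ob => w.
rewrite (redxE x (mf_diff M _ _)) (redxE x (mf_comp (parity i))) !redxE.
congr (prx x _); case: (parity i) (parity j) w => [] [] w;
  by rewrite /= ?linear0 ?mf_comm_phi ?mf_comm_psi.
Qed.
Definition mf_complex_map : chain_map (mf_complex M) (mf_complex N) :=
  @ChainMap _ (mf_complex M) (mf_complex N)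
    (fun i => redx x (mf_comp (parity i))) mf_complex_map_comm.
End Morphisms.

End Reduction.

(* Main.v *)
(** Lift everything to [S]: a linear map between free modules whose reduction
    vanishes is [x = psi phi] times a linear map, and can thus be absorbed by
    changing another term.  Faithfulness uses only the degree 0 part of a null
    homotopy: it lifts to the first homotopy equation over [S], and the second
    one follows from it because [x] is regular.  For fullness, the components of
    a chain map in degrees 0 and 1 lift to a morphism of matrix factorizations,
    after correcting the one in degree 1 by a multiple of [phi]; its reduction
    agrees with the given chain map in degree 0, and chain maps agreeing in
    degree 0 are homotopic, since maps lift along the differential upwards and
    extend along it downwards. *)
Require Import Defs.
From mathcomp Require Import all_boot all_algebra.
From mathcomp Require Import boolp zify.

Set Implicit Arguments.
Unset Strict Implicit.
Unset Printing Implicit Defensive.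

Import GRing.Theory.
Local Open Scope ring_scope.

(** * Dual bases, lifting and division by a scalar for finitely generated free modules *)

Section FreeModules.
Variable R : comPzRingType.
Implicit Types V M N : lmodType R.

Lemma fg_free_dual_basis V : fg_free V ->
  exists n (e : 'I_n -> V) (c : 'I_n -> {linear V -> R^o}),
    forall v, v = \sum_i c i v *: e i.
Proof.
move=> [n [f [f' fK f'K]]].
have cl i : linear (fun v => f' v 0 i : R^o).
  move=> a u v; suff -> : f' (a *: u + v) = a *: f' u + f' v by rewrite !mxE.
  by apply: (can_inj fK); rewrite linearP !f'K.
exists n, (fun i => f (delta_mx 0 i)), (fun i => mklin (cl i)) => v.
rewrite -[LHS]f'K [f' v in LHS]row_sum_delta linear_sum.
by apply: eq_bigr => i _; rewrite linearZ.
Qed.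

Lemma dual_basis_comb_linear V M n (c : 'I_n -> {linear V -> R^o}) (w : 'I_n -> M) :
  linear (fun v => \sum_i c i v *: w i).
Proof.
move=> a u v; rewrite scaler_sumr -big_split; apply: eq_bigr => i _ /=.
by rewrite linearP scalerDl scalerA.
Qed.

(** Preimages of the [f (e i)] are chosen and extended linearly. Only the image of [f] has to be
    reached by [p], so [p] may be a differential or multiplication by a scalar. *)
Lemma fg_free_factor V M N (p : {linear M -> N}) (f : {linear V -> N}) :
  fg_free V -> (forall v, exists z, p z = f v) ->
  exists g : {linear V -> M}, forall v, p (g v) = f v.
Proof.
move=> /fg_free_dual_basis[n [e [c ec]]] pf.
have /choice[w wP] i := pf (e i).
exists (mklin (dual_basis_comb_linear c w)) => v /=.
rewrite [in RHS](ec v) !linear_sum; apply: eq_bigr => i _.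
by rewrite !linearZ wP.
Qed.

Lemma fg_free_projective V : fg_free V -> fg_projective V.
Proof.
move=> Vf; split; last by move=> M N p f ps; apply: fg_free_factor.
have [n [e [c ec]]] := fg_free_dual_basis Vf.
by exists n, e => v; exists (fun i => c i v).
Qed.

(** Applying the coordinates [c i] reduces the claim to the regularity of [x] in [R]. *)
Lemma fg_free_scaler_inj (x : R) V : (forall y : R, x * y = 0 -> y = 0) ->
  fg_free V -> injective (fun v : V => x *: v).
Proof.
move=> x_nzd /fg_free_dual_basis[n [e [c ec]]] u v uv.
apply: subr0_eq; rewrite (ec (u - v)) big1 // => i _.
suff -> : c i (u - v) = 0 by rewrite scale0r.
apply: x_nzd; rewrite -[x * _]/(x *: (c i (u - v) : R^o)) -linearZ /=.
by rewrite scalerBr uv subrr linear0.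
Qed.

Lemma fg_free_factor_scale (x : R) V M (f : {linear V -> M}) :
  fg_free V -> (forall v, exists w, f v = x *: w) ->
  exists g : {linear V -> M}, forall v, f v = x *: g v.
Proof.
move=> Vf fx; have xl : linear (fun w : M => x *: w).
  by move=> a u v; rewrite scalerDr !scalerA mulrC.
have [v|g gP] := fg_free_factor (p := mklin xl) (f := f) Vf.
  by have [w ->] := fx v; exists w.
by exists g => v; rewrite -gP.
Qed.

End FreeModules.

(** * Reduction modulo [x] of free modules and of maps between them *)

Section Reductions.
Variables (S : comPzRingType) (x : S).
Implicit Types F G : lmodType S.

Lemma prx_sum F (I : finType) (u : I -> F) :
  prx x (\sum_i u i) = \sum_i prx x (u i).
Proof. by apply: (big_morph _ (@prxD _ x F) (prx0 x F)). Qed.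

Lemma prxN F (v : F) : prx x (- v) = - prx x v.
Proof. by apply: (addrI (prx x v)); rewrite -prxD !subrr prx0. Qed.

Lemma prx_eq0 F (v : F) : prx x v = 0 <-> exists w, v = x *: w.
Proof. by rewrite -(prx0 x) prxP subr0. Qed.

Lemma fg_free_lift_red F G (k : {linear modx x F -> modx x G}) : fg_free F ->
  exists K : {linear F -> G}, forall v, k (prx x v) = prx x (K v).
Proof.
move=> /fg_free_dual_basis[n [e [c ec]]].
exists (mklin (dual_basis_comb_linear c (fun i => liftx (k (prx x (e i)))))) => v.
rewrite /= prx_sum [in LHS](ec v) prx_sum linear_sum; apply: eq_bigr => i _.
by rewrite !prxZ linearZ liftxK.
Qed.

Lemma fg_free_modx F : fg_free F -> fg_free (modx x F).
Proof.
move=> [n [f [f' fK f'K]]].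
pose h (c : 'rV[quox x]_n) : modx x F := prx x (f (map_mx (@liftq _ x) c)).
(* [h] does not depend on the representatives picked by [liftq]; its linearity and surjectivity
   follow from this. *)
have hE (d : 'rV[S]_n) : h (map_mx (prq x) d) = prx x (f d).
  apply/prxP; have /choice[w wP] i : exists w, liftq (prq x (d 0 i)) - d 0 i = x * w.
    by apply/prqP; rewrite liftqK.
  exists (f (\row_i w i)); rewrite -linearB -linearZ; congr (f _).
  by apply/rowP => i; rewrite !mxE wP.
have map_liftqK (c : 'rV[quox x]_n) : map_mx (prq x) (map_mx (@liftq _ x) c) = c.
  by apply/rowP => i; rewrite !mxE liftqK.
have hl : linear h.
  move=> a c d; rewrite -(map_liftqK c) -(map_liftqK d) -(liftqK a).
  set c' := map_mx _ c; set d' := map_mx _ d; set a' := liftq a.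
  rewrite !hE -prxZ -prxD -linearP -hE; congr h.
  by apply/rowP => i; rewrite !mxE prqD prqM.
exists n, (mklin hl), (fun v => map_mx (prq x) (f' (liftx v))) => [c|v] /=; last first.
  by rewrite hE f'K liftxK.
rewrite -[RHS]map_liftqK; apply/rowP => i; rewrite [LHS]mxE [RHS]mxE.
(* Injectivity: two lifts of [h c] differ by some [x *: w], so their coordinates differ by
   [x *: f' w]. *)
have /prxP[w wP] : prx x (liftx (h c)) = prx x (f (map_mx (@liftq _ x) c)).
  exact: liftxK.
apply/prqP; exists (f' w 0 i).
have -> : f' (liftx (h c)) = map_mx (@liftq _ x) c + x *: f' w.
  apply: (can_inj fK); rewrite linearD linearZ !f'K. by rewrite /= -wP addrC subrK.
by rewrite !mxE addrAC subrr add0r.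
Qed.

End Reductions.

(** * Homotopies constructed degree by degree, starting from degree 0 *)

Section ChainMaps.
Variable R : comPzRingType.
Implicit Types C D : complex R.

(** Degreewise inverses suffice: they commute with the differentials because [f] does and is
    injective. *)
Lemma chain_map_iso (C D : tac_complex R) (f : chain_map C D)
    (g : forall i, {linear D i -> C i}) :
  (forall i, cancel (f i) (g i)) -> (forall i, cancel (g i) (f i)) ->
  @is_iso (Ktac R) C D f.
Proof.
move=> fK gK.
have gc i j v : g j (cx_d D i j v) = cx_d C i j (g i v).
  by apply: (can_inj (fK j)); rewrite gK cm_comm gK.
by exists (ChainMap gc); split; apply: homotopic_eq => i v /=; rewrite ?fK ?gK.
Qed.

(** This continues a homotopy into higher degrees: a map into cycles comes from one degree above. *)
Definition lifting C D := forall i j k, i = j + 1 -> j = k + 1 ->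
  forall k' : {linear C j -> D j}, (forall v, cx_d D j k (k' v) = 0) ->
  exists h : {linear C j -> D i}, forall v, cx_d D i j (h v) = k' v.

(** The dual condition continues a homotopy into lower degrees: a map killing boundaries factors
    through the differential. *)
Definition extension C D := forall i j k, i = j + 1 -> j = k + 1 ->
  forall k' : {linear C j -> D j}, (forall v, k' (cx_d C i j v) = 0) ->
  exists h : {linear C k -> D j}, forall v, h (cx_d C j k v) = k' v.

(** Each step relies on the invariant [Q], so the sequence is built in the subtypes that [Q] cuts
    out. *)
Lemma dependent_choice_nat (A : nat -> Type) (Q : forall n, A n -> Prop)
    (P : forall n, A n -> A n.+1 -> Prop) (a0 : A 0) :
  Q 0 a0 -> (forall n a, Q n a -> exists b, P n a b /\ Q n.+1 b) ->
  exists a : forall n, A n, a 0 = a0 /\ forall n, P n (a n) (a n.+1).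
Proof.
move=> Q0 step.
have s n (a : {a | Q n a}) : {b : {b | Q n.+1 b} | P n (sval a) (sval b)}.
  apply: cid; case: a => a Qa.
  by have [b [Pb Qb]] := step n a Qa; exists (exist _ b Qb).
pose t := fix t n : {a | Q n a} :=
  if n is m.+1 then sval (s m (t m)) else exist _ a0 Q0.
by exists (fun n => sval (t n)); split=> // n; apply: (svalP (s n (t n))).
Qed.


Section Homotopy.
Variables (C D : complex R) (f g : chain_map C D).
Hypotheses (CDl : lifting C D) (CDe : extension C D).
Hypothesis fg0 : forall v, f 0 v = g 0 v.

Let k : chain_map C D := cm_add f (cm_opp g).

(** The next map is a lift of [k - h d], which must therefore take values in cycles. This is the
    invariant [Q]; it persists because [k] is a chain map and [d d = 0]. *)
Lemma homotopy_above :
  exists h : forall n : nat, {linear C n -> D n.+1},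
    h 0 = \0 /\ forall (n : nat) v,
      cx_d D n.+2 n.+1 (h n.+1 v) + h n (cx_d C n.+1 n v) = k n.+1 v.
Proof.
pose Q (n : nat) (h : {linear C n -> D n.+1}) := forall v,
  cx_d D n.+1 n (k n.+1 v - h (cx_d C n.+1 n v)) = 0.
have [|n h Qh|h [h0 hP]] := dependent_choice_nat (Q := Q) (a0 := \0) (P :=
  fun n h h' => forall v,
    cx_d D n.+2 n.+1 (h' v) = k n.+1 v - h (cx_d C n.+1 n v)).
- by move=> v; rewrite subr0 -cm_comm /= fg0 subrr.
- have [||h' h'P] := CDl (i := n.+2) (j := n.+1) (k := n)
    (k' := k n.+1 \- (h \o cx_d C n.+1 n)) _ _ Qh; try lia.
  exists h'; split=> // v; rewrite linearB h'P /= cx_dd.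
  by rewrite linear0 subr0 -(cm_comm k) subrr.
- by exists h; split=> // n v; rewrite hP subrK.
Qed.

(** [Negz n] is the degree [-(n+1)]. Dually to the upward construction, the invariant says that
    [k - d h] vanishes on boundaries, and the next map extends it along the differential. *)
Lemma homotopy_below :
  exists h : forall n : nat, {linear C (Negz n) -> D (- n%:Z)},
    h 0 = \0 /\ forall (n : nat) v,
      cx_d D (- n%:Z) (Negz n) (h n v) + h n.+1 (cx_d C (Negz n) (Negz n.+1) v)
      = k (Negz n) v.
Proof.
pose Q (n : nat) (h : {linear C (Negz n) -> D (- n%:Z)}) := forall v,
  k (Negz n) (cx_d C (- n%:Z) (Negz n) v)
  - cx_d D (- n%:Z) (Negz n) (h (cx_d C (- n%:Z) (Negz n) v)) = 0.
have [|n h Qh|h [h0 hP]] := dependent_choice_nat (Q := Q) (a0 := \0) (P :=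
  fun n h h' => forall v,
    h' (cx_d C (Negz n) (Negz n.+1) v) =
    k (Negz n) v - cx_d D (- n%:Z) (Negz n) (h v)).
- by move=> v; rewrite linear0 subr0 (cm_comm k) /= fg0 subrr linear0.
- have [||h' h'P] := CDe (i := - n%:Z) (j := Negz n) (k := Negz n.+1)
    (k' := k (Negz n) \- (cx_d D (- n%:Z) (Negz n) \o h)) _ _ Qh; try lia.
  exists h'; split=> // v; rewrite h'P linearB /= cx_dd.
  by rewrite subr0 -(cm_comm k) subrr.
- by exists h; split=> // n v; rewrite hP addrC subrK.
Qed.

Lemma homotopic_of_eq0 : homotopic f g.
Proof.
have [u [u0 uP]] := homotopy_above; have [l [l0 lP]] := homotopy_below.
(* The two families are glued by the sign of the source degree; [castm] gives zero unless the target
   is one degree higher. Both families start with zero, which settles degree 0. *)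
pose h (i j : int) : {linear C i -> D j} :=
  match i return {linear C i -> D j} with
  | Posz n => castm D n.+1 j \o u n
  | Negz n => castm D (- n%:Z) j \o l n
  end.
exists h => i j; case: j => [[|n]|n] m ij jm v.
- have -> : f 0 v - g 0 v = 0 by rewrite fg0 subrr.
  have -> : i = 1 by lia.
  have -> : m = Negz 0 by lia.
  by rewrite /h /= !castm_id u0 l0 linear0 addr0.
- have -> : i = n.+2 by lia.
  have -> : m = n by lia.
  by rewrite /h /= !castm_id uP.
- have -> : i = - n%:Z by lia.
  have -> : m = Negz n.+1 by lia.
  by rewrite /h /= !castm_id lP.
Qed.

End Homotopy.
End ChainMaps.

(** * Total acyclicity of the reduced complexes, faithfulness and fullness *)

Section MatrixFactorizations.
Variables (S : comPzRingType) (x : S).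
Hypothesis x_nzd : forall y : S, x * y = 0 -> y = 0.
Implicit Types M N : mf x.

Lemma mf_mod_free M b : fg_free (mf_mod M b).
Proof. by case: b; [apply: mfG_free | apply: mfF_free]. Qed.

Lemma mf_phi_inj M : injective (mf_phi M).
Proof.
move=> u v uv; apply: (fg_free_scaler_inj x_nzd (mfF_free M)).
by rewrite -!mf_psiphi uv.
Qed.

Lemma mf_psi_inj M : injective (mf_psi M).
Proof.
move=> u v uv; apply: (fg_free_scaler_inj x_nzd (mfG_free M)).
by rewrite -!mf_phipsi uv.
Qed.

(** If a lift [w] of the cycle satisfies [d w = x w'] and [d'] is the other map, then
    [d w = d (d' w')], and [w = d' w'] since [d] is injective over [S]. *)
Lemma red_diff_exact M b c d (v : modx x (mf_mod M c)) :
  b = ~~ c -> c = ~~ d -> redx x (mf_diff M c d) v = 0 ->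
  exists u, redx x (mf_diff M b c) u = v.
Proof.
move=> -> cd; rewrite -(liftxK v) redxE => /prx_eq0[].
by case: c d cd {v} (liftx v) => [] [] //= _ v w vw; exists (prx x w);
  rewrite redxE; congr prx; [apply: mf_psi_inj | apply: mf_phi_inj];
  rewrite ?mf_phipsi ?mf_psiphi.
Qed.

(* If [K] lifts [k] and [d], [d'] are the two maps of [M], then [K d = x Q]
   gives [x Q d' = x K], hence [K = Q d']. *)
Lemma red_diff_extend M b c d (W : lmodType S)
    (k : {linear modx x (mf_mod M c) -> modx x W}) :
  fg_free W -> b = ~~ c -> c = ~~ d ->
  (forall v, k (redx x (mf_diff M b c) v) = 0) ->
  exists q : {linear modx x (mf_mod M d) -> modx x W},
    forall v, q (redx x (mf_diff M c d) v) = k v.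
Proof.
move=> Wf -> cd kd.
have [K KP] := fg_free_lift_red k (mf_mod_free M c).
have Kx v : exists w, K (mf_diff M (~~ c) c v) = x *: w.
  by apply/prx_eq0; rewrite -KP -redxE kd.
have [Q QP] := fg_free_factor_scale (f := K \o mf_diff M (~~ c) c)
  (mf_mod_free M (~~ c)) Kx.
have QK v : Q (mf_diff M c (~~ c) v) = K v.
  apply: (fg_free_scaler_inj x_nzd Wf); rewrite -QP -linearZ /=; congr (K _).
  by case: (c) v => v /=; rewrite ?mf_phipsi ?mf_psiphi.
have -> : d = ~~ c by rewrite cd negbK.
exists (redx x Q) => v; rewrite -(liftxK v) !redxE KP.
by rewrite QK.
Qed.

Lemma parity_shift i j : i = j + 1 -> parity i = ~~ parity j.
Proof. by move=> ->; apply: parityS. Qed.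

Lemma mf_cx_dE M i j (v : mf_complex M i) :
  i = j + 1 -> cx_d (mf_complex M) i j v = redx x (mf_diff M (parity i) (parity j)) v.
Proof. by move=> ij; rewrite /= /mf_cx_d; case: (i =P j + 1). Qed.

Lemma mf_complex_free M n : fg_free (mf_complex M n).
Proof. exact/fg_free_modx/mf_mod_free. Qed.

Lemma mf_complex_acyclic M : acyclic (mf_complex M).
Proof.
move=> i j k ij jk v; rewrite mf_cx_dE // => dv.
have [u uP] := red_diff_exact (parity_shift ij) (parity_shift jk) dv.
by exists u; rewrite mf_cx_dE.
Qed.

(** [W] will be [S] for dual acyclicity, and a module of a second factorization for extending
    homotopies. *)
Lemma mf_complex_extend M (W : lmodType S) i j k
    (p : {linear mf_complex M j -> modx x W}) :
  fg_free W -> i = j + 1 -> j = k + 1 ->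
  (forall v, p (cx_d (mf_complex M) i j v) = 0) ->
  exists q : {linear mf_complex M k -> modx x W},
    forall v, q (cx_d (mf_complex M) j k v) = p v.
Proof.
move=> Wf ij jk pd.
have [v|q qP] := red_diff_extend (k := p) Wf (parity_shift ij) (parity_shift jk).
  by rewrite -(pd v) mf_cx_dE.
by exists q => v; rewrite mf_cx_dE // qP.
Qed.

Lemma mf_complex_lifting (C : complex (quox x)) M :
  (forall n, fg_free (C n)) -> lifting C (mf_complex M).
Proof.
move=> Cf i j k ij jk k' k'd; apply: fg_free_factor => // v.
exact: mf_complex_acyclic ij jk _ (k'd v).
Qed.

Lemma mf_complex_extension M N : extension (mf_complex M) (mf_complex N).
Proof.
by move=> i j k ij jk k' k'd; apply: mf_complex_extend ij jk k'd; apply: mf_mod_free.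
Qed.

Lemma fg_free_regular (R : pzRingType) : fg_free R^o.
Proof.
have fl : linear (fun v : 'rV[R]_1 => v 0 0 : R^o) by move=> a u v; rewrite !mxE.
exists 1%N, (mklin fl), (fun a => \row_i a) => [v|a] /=; last by rewrite mxE.
by apply/rowP => i; rewrite mxE ord1.
Qed.

Lemma mf_complex_tac M : totally_acyclic (mf_complex M).
Proof.
split=> [n||i j k ij jk p pd].
- exact/fg_free_projective/mf_complex_free.
- exact: mf_complex_acyclic.
(* [modx x S^o] and the ring [quox x] over itself have the same operations but distinct module
   structures, so [p] and then [q] are repackaged. *)
- have pl : linear (p : mf_complex M j -> modx x S^o) by move=> a u v; exact: linearP.
  have [q qP] := mf_complex_extend (p := mklin pl) (fg_free_regular S) ij jk pd.
  have ql : linear (q : mf_complex M k -> (quox x)^o).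
    by move=> a u v; exact: (linearP q).
  by exists (mklin ql) => v; apply: qP.
Qed.

Lemma mf_complex_map_faithful M N (h h' : mf_hom M N) :
  homotopic (mf_complex_map h) (mf_complex_map h') -> mf_htpy h h'.
Proof.
case=> H HP.
have [t tP] := fg_free_lift_red (F := mfF M) (G := mfG N) (H 0 1) (mfF_free M).
(* Degree -1 is odd, so [H (-1) 0] has the reduction of [mfG M] as source. *)
have [s sP] := fg_free_lift_red (F := mfG M) (G := mfF N) (H (-1) 0) (mfG_free M).
have fx v : exists w, mf_f h v - mf_f h' v - s (mf_phi M v) - mf_psi N (t v) = x *: w.
  apply/prx_eq0; rewrite !prxD !prxN.
  have := HP 1 0 (-1) erefl erefl (prx x v).
  rewrite /= /mf_cx_d /= !(redxE x (mf_f _)) (redxE x (mf_phi M)).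
  rewrite (sP (mf_phi M v)) (tP v) (redxE x (mf_psi N)) => ->.
  by rewrite addrK subrr.
have [q qP] := fg_free_factor_scale (f := ((mf_f h \- mf_f h') \- (s \o mf_phi M))
  \- (mf_psi N \o t)) (mfF_free M) fx.
have {}qP v : mf_f h v - mf_f h' v - s (mf_phi M v) - mf_psi N (t v) = x *: q v.
  exact: qP.
(* The error [x q] equals [psi (phi q)] and is absorbed into [t]. *)
pose t' : {linear mfF M -> mfG N} := t \+ (mf_phi N \o q).
have hf v : mf_f h v - mf_f h' v = s (mf_phi M v) + mf_psi N (t' v).
  by rewrite /= linearD mf_psiphi -qP (addrC (mf_psi N (t v))) subrK [RHS]addrC subrK.
(* The second equation is checked after multiplication by [x = phi psi]: it becomes [phi] applied to
   the first equation at [psi v]. *)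
exists s, t'; split=> // v; apply: (fg_free_scaler_inj x_nzd (mfG_free N)).
rewrite /= -[x *: (_ - _)]mf_phipsi linearB -!mf_comm_psi hf.
by rewrite linearD !mf_phipsi !linearZ -scalerDr addrC.
Qed.

Lemma mf_complex_map_full M N (k : chain_map (mf_complex M) (mf_complex N)) :
  exists h : mf_hom M N, homotopic (mf_complex_map h) k.
Proof.
have [f fP] := fg_free_lift_red (F := mfF M) (G := mfF N) (k 0) (mfF_free M).
have [g1 gP] := fg_free_lift_red (F := mfG M) (G := mfG N) (k 1) (mfG_free M).
have fgx v : exists w, f (mf_psi M v) - mf_psi N (g1 v) = x *: w.
  apply/prxP; have := @cm_comm _ _ _ k 1 0 (prx x v); rewrite /= /mf_cx_d /=.
  by rewrite (redxE x (mf_psi M)) (fP (mf_psi M v)) (gP v) (redxE x (mf_psi N)).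
have [q qP] := fg_free_factor_scale (f := (f \o mf_psi M) \- (mf_psi N \o g1))
  (mfG_free M) fgx.
have {}qP v : f (mf_psi M v) - mf_psi N (g1 v) = x *: q v by exact: qP.
(* Adding [phi q] to [g1] adds [psi phi q = x q] to [psi g1], exactly the defect. *)
pose g : {linear mfG M -> mfG N} := g1 \+ (mf_phi N \o q).
have fg_psi v : f (mf_psi M v) = mf_psi N (g v).
  by rewrite /= linearD mf_psiphi -qP addrC subrK.
(* Both sides agree after the injective [psi]: each becomes [x f]. *)
have fg_phi v : g (mf_phi M v) = mf_phi N (f v).
  by apply: mf_psi_inj; rewrite -fg_psi !mf_psiphi linearZ.
exists (MFHom fg_phi fg_psi).
apply: homotopic_of_eq0.
- by apply: mf_complex_lifting => n; apply: mf_complex_free.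
- exact: mf_complex_extension.
- by move=> v; rewrite -(liftxK v) [RHS]fP /= redxE.
Qed.

End MatrixFactorizations.

(** * Compatibility of the reduction with suspensions and mapping cones *)

Section Triangles.
Variables (S : comPzRingType) (x : S).
Implicit Types M N : mf x.

(** Suspension swaps the two modules, so opposite parities are matched by the identity. Two
    independent indices avoid casts; zero is a default for equal parities. *)
Definition susp_mod M (b c : bool) : {linear mf_mod (mf_susp M) b -> mf_mod M c} :=
  match b, c with
  | false, true => idfun
  | true, false => idfun
  | _, _ => \0
  end.

Definition unsusp_mod M (b c : bool) : {linear mf_mod M c -> mf_mod (mf_susp M) b} :=
  match b, c with
  | false, true => idfun
  | true, false => idfun
  | _, _ => \0
  end.

Lemma susp_modK M b c : c = ~~ b -> cancel (susp_mod M b c) (unsusp_mod M b c).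
Proof. by move=> ->; case: b. Qed.

Lemma unsusp_modK M b c : c = ~~ b -> cancel (unsusp_mod M b c) (susp_mod M b c).
Proof. by move=> ->; case: b. Qed.

Lemma redxK (F G : lmodType S) (f : {linear F -> G}) (g : {linear G -> F}) :
  cancel f g -> cancel (redx x f) (redx x g).
Proof. by move=> fK v; rewrite -(liftxK v) !redxE fK. Qed.

Lemma parity_pred i : parity (i - 1) = ~~ parity i.
Proof. by rewrite -[in RHS](subrK 1 i) parityS negbK. Qed.

(** The signs in the suspension of factorizations match the sign of the shift, so the identification
    itself carries no sign. *)
Lemma red_susp_diff M b b' c c' (v : modx x (mf_mod (mf_susp M) b)) :
  b = ~~ c -> b' = ~~ b -> c' = ~~ c ->
  redx x (susp_mod M c c') (redx x (mf_diff (mf_susp M) b c) v) =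
  - redx x (mf_diff M b' c') (redx x (susp_mod M b b') v).
Proof.
move=> bE b'E c'E; rewrite -(liftxK v) !redxE -prxN; congr prx.
by case: b b' c c' bE b'E c'E {v} (liftx v) => [] [] [] [].
Qed.

Lemma mf_complex_susp_comm M i j (v : mf_complex (mf_susp M) i) :
  redx x (susp_mod M (parity j) (parity (j - 1))) (cx_d (mf_complex (mf_susp M)) i j v)
  = cx_d (shift (mf_complex M)) i j
      (redx x (susp_mod M (parity i) (parity (i - 1))) v).
Proof.
have [ij|ij] := eqVneq i (j + 1); last by rewrite !cx_shape // linear0.
have ij1 : i - 1 = j - 1 + 1 by lia.
rewrite mf_cx_dE // -[RHS]/(- cx_d (mf_complex M) (i - 1) (j - 1) _) mf_cx_dE //.
by apply: red_susp_diff; rewrite ?parity_pred ?(parity_shift ij).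
Qed.

(** This is the natural isomorphism [eta] of the triangle functor. *)
Definition mf_complex_susp M :
    chain_map (mf_complex (mf_susp M)) (shift (mf_complex M)) :=
  @ChainMap _ (mf_complex (mf_susp M)) (shift (mf_complex M))
    (fun i => redx x (susp_mod M (parity i) (parity (i - 1))))
    (@mf_complex_susp_comm M).

Lemma mf_complex_susp_natural M N (h : mf_hom M N) i v :
  mf_complex_susp N i (mf_complex_map (mf_suspm h) i v) =
  shift_map (mf_complex_map h) i (mf_complex_susp M i v).
Proof.
rewrite -(liftxK v) /= !redxE; congr prx; move: (liftx v); rewrite parity_pred.
by case: (parity i).
Qed.

Section Cone.
Variables (M N : mf x) (h : mf_hom M N).

(** Both branches are the second projection, at different types; [mf_mod] computes only once the
    parity is known. *)
Definition cone_snd (b : bool) : {linear mf_mod (mf_cone h) b -> mf_mod N b} :=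
  if b is true then snd else snd.

Definition cone_inl (b c : bool) : {linear mf_mod M c -> mf_mod (mf_cone h) b} :=
  match b, c with
  | false, true => inlm (mfG M) (mfF N)
  | true, false => inlm (mfF M) (mfG N)
  | _, _ => \0
  end.

Definition cone_fst (i : int) :
    {linear mf_complex (mf_cone h) i -> mf_complex M (i - 1)} :=
  mf_complex_susp M i \o mf_complex_map (mf_cone_proj h) i.

Lemma cone_pair_linear i :
  linear (fun v : mf_complex (mf_cone h) i =>
    (cone_fst i v, redx x (cone_snd (parity i)) v) : cone (mf_complex_map h) i).
Proof. by move=> a u v; rewrite !linearP. Qed.

Definition cone_pair i :
    {linear mf_complex (mf_cone h) i -> cone (mf_complex_map h) i} :=
  mklin (@cone_pair_linear i).

(** This is the lower row of the cone differential; the upper row comes from [cone_fst], a composite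
    of chain maps. *)
Lemma red_cone_snd_diff b c (v : modx x (mf_mod (mf_cone h) b)) : b = ~~ c ->
  redx x (cone_snd c) (redx x (mf_diff (mf_cone h) b c) v) =
  redx x (mf_comp h c) (redx x (susp_mod M b c)
    (redx x (mf_comp (mf_cone_proj h) b) v))
  + redx x (mf_diff N b c) (redx x (cone_snd b) v).
Proof.
move=> bE; rewrite -(liftxK v) !redxE -prxD; congr prx.
by case: b c bE {v} (liftx v) => [] [].
Qed.

Lemma mf_complex_cone_comm i j (v : mf_complex (mf_cone h) i) :
  cone_pair j (cx_d (mf_complex (mf_cone h)) i j v) =
  cx_d (cone (mf_complex_map h)) i j (cone_pair i v).
Proof.
have [ij|ij] := eqVneq i (j + 1); last by rewrite !cx_shape // linear0.
congr (_, _).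
  transitivity (cx_d (shift (mf_complex M)) i j (cone_fst i v)).
    exact: (cm_comm (cm_cmp (mf_complex_susp M) (mf_complex_map (mf_cone_proj h))) j v).
  by rewrite -[LHS]addr0.
(* Once [j] is replaced by [i - 1], the cast in the cone differential is the identity. *)
have ? : j = i - 1 by lia.
subst j; rewrite [cx_d (mf_complex (mf_cone h)) _ _ _]mf_cx_dE //.
rewrite (red_cone_snd_diff _ (parity_shift ij)) /= castm_id.
by rewrite /mf_cx_d; case: (i =P i - 1 + 1).
Qed.

Definition mf_complex_cone :
    chain_map (mf_complex (mf_cone h)) (cone (mf_complex_map h)) :=
  @ChainMap _ (mf_complex (mf_cone h)) (cone (mf_complex_map h)) cone_pair
    mf_complex_cone_comm.

Lemma cone_copair_linear i : linear (fun w : cone (mf_complex_map h) i =>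
  redx x (cone_inl (parity i) (parity (i - 1))) w.1
  + redx x (mf_comp (mf_cone_incl h) (parity i)) w.2 : mf_complex (mf_cone h) i).
Proof. by move=> a u v; rewrite /= !linearP scalerDr addrACA. Qed.

Definition cone_copair i :
    {linear cone (mf_complex_map h) i -> mf_complex (mf_cone h) i} :=
  mklin (@cone_copair_linear i).

Lemma cone_pair_prx i (v : mf_mod (mf_cone h) (parity i)) :
  cone_pair i (prx x v) =
  (prx x (susp_mod M _ (parity (i - 1)) (mf_comp (mf_cone_proj h) _ v)),
   prx x (cone_snd _ v)).
Proof. by rewrite /= (redx_funE x (mf_comp _ _)) !redx_funE. Qed.

Lemma cone_copair_prx i a b :
  cone_copair i (prx x a, prx x b) =
  prx x (cone_inl (parity i) (parity (i - 1)) a + mf_comp (mf_cone_incl h) _ b).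
Proof. by rewrite /= !redx_funE -prxD. Qed.

Lemma cone_pairK i : cancel (cone_pair i) (cone_copair i).
Proof.
move=> v; rewrite -(liftxK v) cone_pair_prx cone_copair_prx; congr prx.
move: (liftx v); rewrite parity_pred; by case: (parity i) => -[a b];
  congr (_, _); rewrite /= ?addr0 ?add0r.
Qed.

Lemma cone_copairK i : cancel (cone_copair i) (cone_pair i).
Proof.
move=> [a b]; rewrite -(liftxK a) -(liftxK b) cone_copair_prx cone_pair_prx.
congr (_, _); congr prx; move: (liftx a) (liftx b); rewrite parity_pred;
  by case: (parity i) => u v; rewrite /= ?addr0 ?add0r.
Qed.

Lemma mf_complex_cone_incl i v :
  mf_complex_cone i (mf_complex_map (mf_cone_incl h) i v) =
  cone_incl (mf_complex_map h) i v.
Proof.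
(* The inclusion is the inverse comparison map on pairs [(0, v)]. *)
have -> : mf_complex_map (mf_cone_incl h) i v = cone_copair i (0, v).
  by rewrite /= !linear0 add0r.
exact: cone_copairK.
Qed.

End Cone.
End Triangles.

(** * Functoriality up to homotopy and the image of a distinguished triangle *)

Lemma is_iso_cmp (C : category) (X Y Z : C) (g : Mor Y Z) (f : Mor X Y) :
  is_iso g -> is_iso f -> is_iso (cmp g f).
Proof.
move=> [g' [g'g gg']] [f' [f'f ff']]; exists (cmp f' g'); split.
  apply: heq_trans (cmpA _ _ _) _; apply: heq_trans f'f; apply: cmp_heq (heq_refl _).
  apply: heq_trans (heq_sym (cmpA _ _ _)) _.
  by apply: heq_trans (cmp_heq (heq_refl _) g'g) _; apply: cmpm1.
apply: heq_trans (cmpA _ _ _) _; apply: heq_trans gg'; apply: cmp_heq (heq_refl _).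
apply: heq_trans (heq_sym (cmpA _ _ _)) _.
by apply: heq_trans (cmp_heq (heq_refl _) ff') _; apply: cmpm1.
Qed.

Lemma additive_functor_iso (C D : preadditive) (T0 : C -> D)
    (T1 : forall X Y, Mor X Y -> Mor (T0 X) (T0 Y)) (X Y : C) (f : Mor X Y) :
  additive_functor T1 -> is_iso f -> is_iso (T1 X Y f).
Proof.
move=> [T_heq T_id T_cmp _] [g [gf fg]]; exists (T1 _ _ g); split.
  apply: heq_trans (heq_sym (T_cmp _ _ _ _ _)) _.
  by apply: heq_trans (T_heq _ _ _ _ gf) _; apply: T_id.
apply: heq_trans (heq_sym (T_cmp _ _ _ _ _)) _.
by apply: heq_trans (T_heq _ _ _ _ fg) _; apply: T_id.
Qed.

Lemma mf_complex_map_additive (S : comPzRingType) (x : S)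
    (x_nzd : forall y : S, x * y = 0 -> y = 0) :
  @additive_functor (HMF x) (Ktac (quox x))
    (fun M => Tac (mf_complex_tac x_nzd M)) (fun M N h => mf_complex_map h).
Proof.
split.
- move=> M N h h' [s [t [hf hg]]].
  (* The pair [s], [t] is repeated with period two to give a homotopy in all degrees. *)
  pose H (b c : bool) : {linear mf_mod M b -> mf_mod N c} :=
    match b, c with
    | false, true => t
    | true, false => s
    | _, _ => \0
    end.
  exists (fun i j => redx x (H (parity i) (parity j))) => i j k ij jk v.
  rewrite !mf_cx_dE // -(liftxK v) /= !redx_funE -prxN -!prxD; congr prx.
  move: (parity_shift ij) (parity_shift jk) {v} (liftx v).
  case: (parity i) (parity j) (parity k) => [] [] [] //= _ _ v.
    by rewrite hf addrC.
  by rewrite hg addrC.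
- move=> M; apply: homotopic_eq => i v.
  rewrite -(liftxK v) /= redx_funE; congr prx.
  by case: (parity i) {v} (liftx v).
- move=> M N P g f; apply: homotopic_eq => i v.
  rewrite -(liftxK v) /= !redx_funE; congr prx.
  by case: (parity i) {v} (liftx v).
- move=> M N f g; apply: homotopic_eq => i v.
  rewrite -(liftxK v) /= !redx_funE -prxD; congr prx.
  by case: (parity i) {v} (liftx v).
Qed.

(** Freeness is stated separately because objects of [Ktac] record only projectivity; [T_tac]
    supplies just the proof component of these objects. *)
Theorem theorem3p4 (S : comPzRingType) (x : S)
    (x_nzd : forall y : S, x * y = 0 -> y = 0) :
  (forall (M : HMF x) (n : int), fg_free (mf_complex M n)) /\
  exists T_tac : forall M : HMF x, totally_acyclic (mf_complex M),
    let T0 : HMF x -> Ktac (quox x) := fun M => Tac (T_tac M) in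
    let T1 : forall M N : HMF x, Mor M N -> Mor (T0 M) (T0 N) :=
      fun M N theta => mf_complex_map theta in
    [/\ triangle_functor T1, full_functor T1 & faithful_functor T1].
Proof.
split; first by move=> M n; apply: mf_complex_free.
exists (mf_complex_tac x_nzd) => T0 T1.
have T_add : additive_functor T1 := mf_complex_map_additive x_nzd.
split=> //.
- split=> //; exists (fun M => mf_complex_susp M); split.
  + move=> M.
    refine (@chain_map_iso _ (T0 (susp M)) (tac_shift (T0 M)) (mf_complex_susp M)
      (fun i => redx x (unsusp_mod M (parity i) (parity (i - 1)))) _ _) => i.
      exact/redxK/susp_modK/parity_pred.
    exact/redxK/unsusp_modK/parity_pred.
  + by move=> M N h; apply: homotopic_eq => i v; apply: mf_complex_susp_natural.
  + move=> X Y Z u v w [M [N [h [a [b [c [[ai bi ci] [uab vbc wca]]]]]]]].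
    have [T_heq _ T_cmp _] := T_add.
    (* Functors preserve squares commuting up to homotopy. *)
    have Tsq (A B B' E : HMF x) (p : Mor B E) (q : Mor A B) (p' : Mor B' E)
        (q' : Mor A B') :
        heq (cmp p q) (cmp p' q') ->
        heq (cmp (T1 _ _ p) (T1 _ _ q)) (cmp (T1 _ _ p') (T1 _ _ q')).
      move=> pq; apply: heq_trans (heq_sym (T_cmp _ _ _ _ _)) _.
      by apply: heq_trans (T_cmp _ _ _ _ _); apply: T_heq.
    (* The image triangle is compared with the standard triangle of [T1 _ _ h]: the third component
       is the image of [c] followed by the cone comparison. *)
    exists (T0 M), (T0 N), (T1 _ _ h).
    exists (T1 _ _ a), (T1 _ _ b), (cm_cmp (mf_complex_cone h) (T1 _ _ c)).
    split; split.
    * exact: additive_functor_iso.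
    * exact: additive_functor_iso.
    * apply: (is_iso_cmp (C := Ktac _) (Y := T0 (mf_cone h))).
        refine (@chain_map_iso _ (T0 (mf_cone h)) (tac_cone (T1 _ _ h))
          (mf_complex_cone h) _ (@cone_pairK _ _ _ _ h) (@cone_copairK _ _ _ _ h)).
      exact: additive_functor_iso.
    * exact: Tsq.
    * apply: homotopic_trans (cm_cmp_homotopic (homotopic_refl (mf_complex_cone h))
        (Tsq _ _ _ _ _ _ _ _ vbc)) _.
      by apply: homotopic_eq => i z; apply: mf_complex_cone_incl.
    (* The cone comparison followed by [cone_proj] is by construction [eta] after the image of
       [mf_cone_proj]; what remains is naturality of [eta]. *)
    * apply: homotopic_trans _ (cm_cmp_homotopic (homotopic_refl (mf_complex_susp M))
        (Tsq _ _ _ _ _ _ _ _ wca)).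
      by apply: homotopic_eq => i z; rewrite /= -mf_complex_susp_natural.
- by move=> M N k; apply: mf_complex_map_full.
- by move=> M N h h'; apply: mf_complex_map_faithful.
Qed.
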